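(* Let $\mathcal{M}$ be a finite-horizon Markov decision process with state space $\mathcal{S}\subseteq\mathbb{R}^d$, finite action space $\mathcal{A}$, discount factor $\gamma<1$, horizon $T$, rewards $r_t(s,a)$ and transition kernels $P_t(\cdot\mid s,a)$, $t=1,\dots,T$. Let $\phi:\mathcal{S}\times\mathcal{A}\to\mathbb{R}^d$ be a known feature map and assume that $\mathcal{M}$ is a linear MDP: for every $t$, $r_t(s,a)=\beta_t\cdot\phi(s,a)$, $q_t^\pi(s,a)=\theta_t^\pi\cdot\phi(s,a)$ (for policies $\pi$) and $P_t(\cdot\mid s,a)=\mu_t\,\phi(s,a)$. Let $\rho\subseteq\{1,\dots,d\}$ be an index set, with complement $\rho_c$, such that for every $t$: (i) $r_t(s,a)=r_t(\tilde s,a)$ whenever $s^\rho=\tilde s^\rho$; (ii) $s_{t+1}^\rho$ is independent of $s_t^{\rho_c}$ given $(s_t^\rho,a_t)$, so that $P(s_{t+1}^\rho\mid s_t,a_t)=P(s_{t+1}^\rho\mid s_t^\rho,a_t)$. Then the optimal policy is sparse: for states $s_t,\tilde s_t$ and optimal policies $\pi^*_t(s_t)\in\arg\max_{a\in\mathcal{A}}q^*_t(s_t,a)$ and $\tilde\pi^*_t(\tilde s_t)\in\arg\max_{a\in\mathcal{A}}q^*_t(\tilde s_t,a)$, when $s_t^\rho=\tilde s_t^\rho$, $$\pi^*_t(s_t)=\tilde\pi^*_t(\tilde s_t).$$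
   Context: For a vector $s\in\mathbb{R}^d$ and an index set $\rho\subseteq\{1,\dots,d\}$, $s^\rho=(s_k)_{k\in\rho}$ denotes the subvector of $s$ with coordinates in $\rho$. For a policy $\pi$, $q_t^\pi(s,a)=\mathbb{E}_\pi\big[\sum_{t'=t}^T\gamma^{t'-t}r_{t'}\mid s_t=s,a_t=a\big]$, where $\mathbb{E}_\pi$ is the expectation when actions are chosen by $\pi$ and $s_{t+1}\sim P_t(\cdot\mid s_t,a_t)$. The optimal $q$-functions satisfy $q^*_{T+1}\equiv 0$ and $$q^*_t(s,a)=r_t(s,a)+\gamma\,\mathbb{E}\Big[\max_{a'\in\mathcal{A}}q^*_{t+1}(s_{t+1},a')\,\Big|\,s_t=s,a_t=a\Big],\qquad t=T,\dots,1 .$$ In the linear MDP condition, $\beta_t,\theta_t^\pi\in\mathbb{R}^d$, and $P_t(\cdot\mid s,a)=\mu_t\,\phi(s,a)$ means that the transition law is linear in the features, $P_t(B\mid s,a)=\sum_{j=1}^d\mu_{t,j}(B)\,\phi_j(s,a)$ for measurable $B\subseteq\mathcal{S}$, with $\mu_{t,j}$ signed measures on $\mathcal{S}$.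
   Formalization: With ties, two optimal policies may differ (r=0, two actions), so the conclusion is that the argmax sets at s_t and s̃_t coincide, and the actions agree if the maximizer is unique or ties are broken by a common rule; the state space is taken Borel and rewards measurable. *)

(* Defs.v *)
From HB Require Import structures.
From mathcomp Require Import all_boot all_order all_algebra.
From mathcomp Require Import all_classical all_reals all_analysis.

Set Implicit Arguments.
Unset Strict Implicit.
Unset Printing Implicit Defensive.
Import Order.TTheory GRing.Theory Num.Theory.
Local Open Scope classical_set_scope.
Local Open Scope ring_scope.

(* Points of R^d are d-tuples, which carry the product (Borel) sigma-algebra. *)

Definition dot (R : realType) (d : nat) (u v : d.-tuple R) : R :=
  \sum_(j < d) tnth u j * tnth v j.

Definition subvec (R : realType) (d : nat) (rho : {set 'I_d})
    (s : d.-tuple R) : #|rho|.-tuple R :=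
  [tuple tnth s (enum_val k) | k < #|rho|].

(* The state space is a Borel subset of R^d.  The reward functions and the
   kernels are total on R^d, but only their values at states are constrained
   or used; [trans t a s] is the law P_t(. | s, a), carried by the states.
   Time indices outside 1, ..., horizon are irrelevant. *)
Record mdp (R : realType) (d : nat) (A : finType) := MDP {
  states : set (d.-tuple R);
  horizon : nat;
  discount : R;
  reward : nat -> d.-tuple R -> A -> R;
  trans : nat -> A -> R.-pker (d.-tuple R) ~> (d.-tuple R);
  measurable_states : measurable states;
  discount_lt1 : discount < 1;
  measurable_reward :
    forall t a, measurable_fun states (fun s => reward t s a);
  trans_states : forall t a s, states s -> trans t a s states = 1%E }.

Definition epoch (R : realType) (d : nat) (A : finType) (M : mdp R d A)
    (t : nat) : Prop := (1 <= t <= horizon M)%N.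

(* Randomized Markov policies, [policy_prob pi t s a] being the probability of
   playing a in state s at time t; deterministic policies are the 0/1-valued
   ones. *)
Record policy (R : realType) (d : nat) (A : finType) (M : mdp R d A) :=
  Policy {
  policy_prob :> nat -> d.-tuple R -> A -> R;
  policy_ge0 : forall t s a, states M s -> 0 <= policy_prob t s a;
  policy_sum1 : forall t s, states M s -> \sum_(a : A) policy_prob t s a = 1;
  measurable_policy :
    forall t a, measurable_fun (states M) (fun s => policy_prob t s a) }.

(* [traj_expect pi n t s a G] is E_pi[G(w) | s_t = s, a_t = a] for the
   trajectory w = (s_u, a_u) over the times u = t, ..., t + n: given the past,
   s_{u+1} has law P_u(. | s_u, a_u) and a_{u+1} has law pi_{u+1}(. | s_{u+1}).
   The values of w outside t, ..., t + n are arbitrary. *)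
Fixpoint traj_expect (R : realType) (d : nat) (A : finType) (M : mdp R d A)
    (pi : policy M) (n t : nat) (s : d.-tuple R) (a : A)
    (G : (nat -> d.-tuple R * A) -> R) : R :=
  if n is n'.+1 then
    \int[trans M t a s]_(s' in states M)
      \sum_(a' : A) pi t.+1 s' a' *
        traj_expect pi n' t.+1 s' a'
          (fun w => G (fun u => if u == t then (s, a) else w u))
  else G (fun=> (s, a)).

Definition qpi (R : realType) (d : nat) (A : finType) (M : mdp R d A)
    (pi : policy M) (t : nat) (s : d.-tuple R) (a : A) : R :=
  traj_expect pi (horizon M - t) t s a (fun w =>
    \sum_(t <= t' < (horizon M).+1)
      discount M ^+ (t' - t) * reward M t' (w t').1 (w t').2).

(* n is the number of remaining decisions; [A] being finite, the supremum is
   the maximum over the actions. *)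
Fixpoint qstar_rec (R : realType) (d : nat) (A : finType) (M : mdp R d A)
    (n t : nat) (s : d.-tuple R) (a : A) : R :=
  if n is n'.+1 then
    reward M t s a + discount M *
      \int[trans M t a s]_(s' in states M)
        sup [set qstar_rec M n' t.+1 s' a' | a' in [set: A]]
  else 0.

Definition qstar (R : realType) (d : nat) (A : finType) (M : mdp R d A)
    (t : nat) : d.-tuple R -> A -> R :=
  qstar_rec M ((horizon M).+1 - t) t.

Lemma qstar_end (R : realType) (d : nat) (A : finType) (M : mdp R d A) s a :
  qstar M (horizon M).+1 s a = 0.
Proof. by rewrite /qstar subnn. Qed.

Lemma qstar_bellman (R : realType) (d : nat) (A : finType) (M : mdp R d A)
    t s a : epoch M t ->
  qstar M t s a = reward M t s a + discount M *
    \int[trans M t a s]_(s' in states M)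
      sup [set qstar M t.+1 s' a' | a' in [set: A]].
Proof. by move=> /andP[_ tT]; rewrite /qstar subSn. Qed.

Lemma sup_is_max (R : realType) (A : finType) (f : A -> R) (a0 : A) :
  exists2 a, sup [set f a' | a' in [set: A]] = f a & forall a', f a' <= f a.
Proof.
pose a := [arg max_(a > a0) f a]%O.
have fa a' : f a' <= f a by rewrite /a; case: arg_maxP => // b _; apply.
exists a => //; apply/eqP; rewrite eq_le; apply/andP; split.
  by apply: ge_sup => [|_ [a' _ <-]//]; exists (f a), a.
by apply: ub_le_sup; [exists (f a) => _ [a' _ <-]|exists a].
Qed.

Definition argmax (R : realType) (A : Type) (f : A -> R) : set A :=
  [set a | forall a', f a' <= f a].

(* {charge set _ -> \bar R} is the type of finite signed measures. *)
Definition linear_mdp (R : realType) (d : nat) (A : finType) (M : mdp R d A)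
    (phi : d.-tuple R -> A -> d.-tuple R) : Prop :=
  [/\ exists beta : nat -> d.-tuple R, forall t s a,
        epoch M t -> states M s -> reward M t s a = dot (beta t) (phi s a),
      forall pi : policy M, exists theta : nat -> d.-tuple R, forall t s a,
        epoch M t -> states M s -> qpi pi t s a = dot (theta t) (phi s a)
    & exists mu : nat -> 'I_d -> {charge set (d.-tuple R) -> \bar R},
        forall t s a B, epoch M t -> states M s ->
        measurable B -> B `<=` states M ->
        trans M t a s B =
          (\sum_(j < d) mu t j B * (tnth (phi s a) j)%:E)%E].

Definition reward_depends_on (R : realType) (d : nat) (A : finType)
    (M : mdp R d A) (rho : {set 'I_d}) (t : nat) : Prop :=
  forall s s' a, states M s -> states M s' -> subvec rho s = subvec rho s' ->
    reward M t s a = reward M t s' a.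

(* Conditional independence of s_{t+1}^rho and the other coordinates of s_t
   given (s_t^rho, a_t), at the level of the transition kernel: the law of
   s_{t+1}^rho given (s_t, a_t) is a law [K] indexed by (s_t^rho, a_t).  No
   measurability of [K] in its first argument is required. *)
Definition trans_depends_on (R : realType) (d : nat) (A : finType)
    (M : mdp R d A) (rho : {set 'I_d}) (t : nat) : Prop :=
  exists K : #|rho|.-tuple R -> A -> probability (#|rho|.-tuple R) R,
    forall s a C, states M s -> measurable C ->
      trans M t a s [set s' | C (subvec rho s')] = K (subvec rho s) a C.

Definition common_tie_breaking (R : realType) (d : nat) (A : finType)
    (M : mdp R d A) (pi pi' : nat -> d.-tuple R -> A) : Prop :=
  exists sel : set A -> A, forall t s, epoch M t -> states M s ->
    pi t s = sel (argmax (qstar M t s)) /\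
    pi' t s = sel (argmax (qstar M t s)).

(* Main.v *)
(** By backward induction, q*_t(., a) is measurable on the states and depends
there only on s^rho.  In the induction step two transition laws p and p' have
the same image under s |-> s^rho, and the value function V at time t + 1 must
have the same integral under both.  V need not factor through s^rho in a
measurable way, as the image of a Borel set of states under s |-> s^rho is only
analytic.  Inner regularity avoids this: if B is a Borel set of states that is
saturated for s |-> s^rho and K is a compact subset of B with p(B \ K) < e, then
the image C of K is compact, hence Borel, and
  p(B) - e <= p(K) <= p(s^rho in C) = p'(s^rho in C) <= p'(B),
the last step by saturation.  So p and p' agree on the saturated Borel sets, in
particular on the sets (V in E), and V has the same law under both. *)

Require Import Defs.
From HB Require Import structures.
From mathcomp Require Import all_boot all_order all_algebra.
From mathcomp Require Import all_classical all_reals all_analysis.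
From mathcomp Require Import measurable_realfun.

Set Implicit Arguments.
Unset Strict Implicit.
Unset Printing Implicit Defensive.
Import Order.TTheory GRing.Theory Num.Theory.
Import numFieldNormedType.Exports.
Local Open Scope classical_set_scope.
Local Open Scope ring_scope.

(** * Topology and compact sets in R^d *)

(** Tuples carry the Borel sigma-algebra and row vectors the topology; this bijection lets the two
    structures be compared. *)
Definition row_of (R : realType) (d : nat) (s : d.-tuple R) : 'rV[R]_d :=
  \row_(i < d) tnth s i.

Definition of_row (R : realType) (d : nat) (v : 'rV[R]_d) : d.-tuple R :=
  [tuple v ord0 i | i < d].

Lemma row_ofK (R : realType) d : cancel (@row_of R d) (@of_row R d).
Proof. by move=> s; apply: eq_from_tnth => i; rewrite tnth_mktuple mxE. Qed.

Lemma of_rowK (R : realType) d : cancel (@of_row R d) (@row_of R d).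
Proof. by move=> v; apply/rowP => i; rewrite mxE tnth_mktuple. Qed.

(* U is a countable union of open boxes with rational centres. *)
Lemma measurable_row_of_open (R : realType) d (U : set 'rV[R]_d) :
  open U -> measurable (@row_of R d @^-1` U).
Proof.
move=> oU.
pose D (qk : 'rV[rat]_d * nat) : set (d.-tuple R) :=
  [set s | forall i, `|ratr (qk.1 ord0 i) - tnth s i| < qk.2.+1%:R^-1].
pose inU (qk : 'rV[rat]_d * nat) :=
  ball (map_mx ratr qk.1 : 'rV[R]_d) qk.2.+1%:R^-1 `<=` U.
have -> : @row_of R d @^-1` U =
    \bigcup_qk (if `[< inU qk >] then D qk else set0).
  apply/seteqP; split => [s /= Us|s [[q k] _] /=]; last first.
    case: asboolP => // + Ds; apply; split => [|i j /=]; first by rewrite invr_gt0.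
    by rewrite !mxE ord1; exact: Ds.
  have /nbhs_ballP[e /= e0 eU] : nbhs (row_of s) U by apply: open_nbhs_nbhs.
  (* A box of radius below [e / 2], centred at a rational point that close to [s], stays within [e]
     of [s] and hence inside [U]. *)
  have e2 : 0 < e / 2 by rewrite divr_gt0.
  have [k _ /(_ k (leqnn k)) /= ke] := near_infty_natSinv_lt (PosNum e2).
  have k0 : 0 < k.+1%:R^-1 :> R by rewrite invr_gt0.
  have qP i : exists q : rat, `|ratr q - tnth s i| < k.+1%:R^-1.
    have [|q] := @rat_in_itvoo R (tnth s i) (tnth s i + k.+1%:R^-1).
      by rewrite ltrDl.
    rewrite in_itv /= => /andP[q1 q2]; exists q.
    by rewrite ger0_norm ?subr_ge0 ?ltW// ltrBlDl.
  have [q qE] := choice qP.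
  exists (\row_i q i, k) => //; case: asboolP => [_ i /=|[]].
    by rewrite mxE; exact: qE.
  move=> v [_ /= vq]; apply: eU; split=> // i j; rewrite ord1.
  have /= := vq ord0 j; rewrite !mxE /ball /= => vj.
  rewrite (le_lt_trans (ler_distD (ratr (q j)) _ _))// [ltRHS]splitr.
  by rewrite ltrD// ?(lt_trans vj)// distrC (lt_trans (qE j)).
apply: countable_bigcupT_measurable => [|qk]; first exact: countableP.
case: asboolP => // _.
rewrite [D qk](_ : _ = \bigcap_(i in [set: 'I_d])
  ((fun s => tnth s i) @^-1` [set x | `|ratr (qk.1 ord0 i) - x| < qk.2.+1%:R^-1])).
  apply: fin_bigcap_measurable => // i _; rewrite -[X in measurable X]setTI.
  apply: (@measurable_tnth _ R) => //.
  rewrite [X in measurable X](_ : _ =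
    `]ratr (qk.1 ord0 i) - qk.2.+1%:R^-1, ratr (qk.1 ord0 i) + qk.2.+1%:R^-1[%classic).
    exact: measurable_itv.
  by apply/seteqP; split => x /=; rewrite in_itv /= distrC ltr_distl.
by apply/seteqP; split => s Ds i => [_|]; exact: Ds.
Qed.

(* The topology of R^d is that of 'rV[R]_d. *)
Definition tuple_compact (R : realType) d (K : set (d.-tuple R)) :=
  compact (@of_row R d @^-1` K : set 'rV[R]_d).

Lemma tuple_compact_closed (R : realType) d (K : set (d.-tuple R)) :
  tuple_compact K -> closed (@of_row R d @^-1` K : set 'rV[R]_d).
Proof. by move=> /compact_closed; apply; exact: norm_hausdorff. Qed.

Lemma tuple_compact_measurable (R : realType) d (K : set (d.-tuple R)) :
  tuple_compact K -> measurable K.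
Proof.
move=> /tuple_compact_closed/closed_openC/measurable_row_of_open/measurableC.
congr (measurable _); apply/seteqP; split => s /=; rewrite row_ofK //.
  by move=> /contrapT.
by move=> ? [].
Qed.

Lemma tuple_compact_box (R : realType) d (a b : 'I_d -> R) :
  tuple_compact [set s | forall i, a i <= tnth s i <= b i].
Proof.
have /rV_compact := fun i => @segment_compact R (a i) (b i).
congr compact; apply/seteqP; split => v /= vab i; have := vab i;
  by rewrite tnth_mktuple in_itv.
Qed.

Lemma tuple_compactU (R : realType) d (K L : set (d.-tuple R)) :
  tuple_compact K -> tuple_compact L -> tuple_compact (K `|` L).
Proof. exact: compactU. Qed.

Lemma tuple_compact_bigcap (R : realType) d (K : nat -> set (d.-tuple R)) :
  (forall n, tuple_compact (K n)) -> tuple_compact (\bigcap_n K n).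
Proof.
move=> cK; apply: (subclosed_compact _ (cK 0%N)) => [|v /(_ 0%N)]; last exact.
rewrite preimage_bigcap; apply: closed_bigI => n _.
exact: tuple_compact_closed.
Qed.

(** Selecting coordinates does not increase the sup distance, so it is continuous. *)
Lemma tuple_compact_subvec (R : realType) d (rho : {set 'I_d}) K :
  tuple_compact K -> tuple_compact (@subvec R d rho @` K).
Proof.
move=> cK; pose f (v : 'rV[R]_d) : 'rV[R]_#|rho| :=
  \row_k v ord0 (enum_val k).
have cf : continuous f.
  move=> v P /nbhs_ballP[e /= e0 eP]; apply/nbhs_ballP; exists e => //= w [_ vw].
  by apply: eP; split => // i j; rewrite !mxE; exact: vw.
have := continuous_compact (continuous_subspaceT cf) cK.
congr compact; apply/seteqP; split => [_ [v Kv <-]|v [s Ks sv]] /=.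
  exists (of_row v) => //; apply: eq_from_tnth => k.
  by rewrite !tnth_mktuple mxE.
exists (row_of s); first by rewrite /= row_ofK.
apply/rowP => k; rewrite !mxE.
by have /(congr1 (fun t => tnth t k)) := sv; rewrite !tnth_mktuple.
Qed.

(** * Inner regularity of finite measures *)

(** Inner regularity by compact sets at the single set [A], so that a good-sets argument can run
    over [A]. *)
Definition tight (R : realType) d (p : {measure set (d.-tuple R) -> \bar R})
    (A : set (d.-tuple R)) :=
  forall e : R, 0 < e -> exists K,
    [/\ tuple_compact K, K `<=` A & (p (A `\` K) < e%:E)%E].

Lemma tuple_compact_tight (R : realType) d (p : {measure set (d.-tuple R) -> \bar R}) K :
  tuple_compact K -> tight p K.
Proof.
by move=> cK e e0; exists K; split => //; rewrite setDv measure0 lte_fin.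
Qed.

Lemma tightU (R : realType) d (p : {measure set (d.-tuple R) -> \bar R}) A B :
  measurable A -> measurable B -> tight p A -> tight p B -> tight p (A `|` B).
Proof.
move=> mA mB tA tB e e0; have e2 : 0 < e / 2 by rewrite divr_gt0.
have [K [cK KA AK]] := tA _ e2; have [L [cL LB BL]] := tB _ e2.
exists (K `|` L); split; [exact: tuple_compactU|exact: setUSS|].
have mK := tuple_compact_measurable cK; have mL := tuple_compact_measurable cL.
rewrite (@le_lt_trans _ _ (p ((A `\` K) `|` (B `\` L)))) //.
  apply: le_measure; rewrite ?inE;
    [apply: measurableD; exact: measurableU|apply: measurableU; exact: measurableD|].
  by move=> s [[As|Bs] /not_orP[nK nL]]; [left|right].
rewrite (splitr e) EFinD.
apply: le_lt_trans (lteD AK BL); apply: measureU2; exact: measurableD.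
Qed.

(** As [p] is finite, continuity from above makes the mass missed by the finite unions [G n] tend to
    0; a compact subset of one late [G n] then suffices. *)
Lemma tight_bigcup (R : realType) d (p : {measure set (d.-tuple R) -> \bar R})
    (F : nat -> set (d.-tuple R)) : fin_num_fun p ->
  (forall n, measurable (F n)) -> (forall n, tight p (F n)) ->
  tight p (\bigcup_n F n).
Proof.
move=> pfin mF tF e e0; have e2 : 0 < e / 2 by rewrite divr_gt0.
pose G n := \big[setU/set0]_(i < n) F i.
have mG n : measurable (G n) by exact: bigsetU_measurable.
have mU : measurable (\bigcup_n F n) by exact: bigcup_measurable.
have tG n : tight p (G n).
  rewrite /G; elim: n => [|n ih].
    by rewrite big_ord0; apply: tuple_compact_tight; exact: compact0.
  by rewrite big_ord_recr; apply: tightU => //; exact: mG.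
have mD n : measurable (\bigcup_n F n `\` G n) by exact: measurableD.
have GE : \bigcap_n (\bigcup_n F n `\` G n) = set0.
  apply/seteqP; split => // s sG; have [[n _ Fs] _] := sG 0%N I.
  (* [G n] stops just before [F n], so a point of [F n] is excluded at index [n.+1]. *)
  have [_ []] := sG n.+1 I; rewrite /G -bigcup_mkord; by exists n => /=.
pose D n := \bigcup_n F n `\` G n.
have : p \o D @ \oo --> p (\bigcap_n D n).
  apply: nonincreasing_cvg_mu => //.
  - rewrite -ge0_fin_numE//. apply: pfin; exact: mD.
  - by rewrite [X in measurable X]GE.
  - move=> n m nm; apply/subsetPset; apply: setDS; rewrite /G.
    exact: subset_bigsetU.
rewrite [X in p X]GE measure0 => /(_ [set x | x < (e / 2)%:E]%E)[].
  apply: open_nbhs_nbhs; split; last by rewrite /= lte_fin.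
  exact: open_ereal_lt_ereal.
move=> n _ /(_ n (leqnn n)) /= pn.
have [K [cK KG GK]] := tG n _ e2.
have mK := tuple_compact_measurable cK.
exists K; split => //.
  apply: (subset_trans KG); rewrite /G -bigcup_mkord.
  by apply: bigcup_sub => i _ s Fs; exists i.
rewrite (@le_lt_trans _ _ (p ((\bigcup_n F n `\` G n) `|` (G n `\` K)))) //.
  apply: le_measure; rewrite ?inE; [exact: measurableD| |].
    by apply: measurableU => //; exact: measurableD.
  by move=> s [Us nK]; have [Gs|nG] := pselect (G n s); [right|left].
rewrite (splitr e) EFinD.
by apply: le_lt_trans (lteD pn GK); apply: measureU2; exact: measurableD.
Qed.

(** A point of the intersection outside every-index compactness, that is outside [\bigcap_n K n],
    lies in some [F n] but not in [K n], so countable subadditivity bounds the error by the sum of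
    the errors. *)
Lemma tight_bigcap (R : realType) d (p : {measure set (d.-tuple R) -> \bar R})
    (F : nat -> set (d.-tuple R)) :
  (forall n, measurable (F n)) -> (forall n, tight p (F n)) ->
  tight p (\bigcap_n F n).
Proof.
move=> mF tF e e0.
have e2 : 0 < e / 2 by rewrite divr_gt0.
(* The series of these errors is bounded by [e / 2], which leaves the strict inequality with [e]. *)
have en (n : nat) : 0 < e / 2 / (2 ^ n.+1)%:R.
  by rewrite divr_gt0// ltr0n expn_gt0.
have [K KP] := choice (fun n => tF n _ (en n)).
have cK n : tuple_compact (K n) by case: (KP n).
have mK n := tuple_compact_measurable (cK n).
exists (\bigcap_n K n); split.
- exact: tuple_compact_bigcap.
- by move=> s Ks n _; case: (KP n) => _ + _; apply; exact: Ks.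
have mFK n : measurable (F n `\` K n) by exact: measurableD.
apply: (@le_lt_trans _ _ (\sum_(0 <= n <oo) p (F n `\` K n))%E).
  apply: measure_sigma_subadditive => //.
    by apply: measurableD; exact: bigcap_measurable.
  move=> s [Fs nK]; have /existsNP[n /not_implyP[_ nKs]] := nK.
  by exists n => //; split=> //; exact: Fs.
apply: (@le_lt_trans _ _ (\sum_(0 <= n <oo) (e / 2 / (2 ^ n.+1)%:R)%:E)%E).
  by apply: lee_nneseries => // n _; case: (KP n) => _ _ /ltW.
apply: le_lt_trans (epsilon_trick0 xpredT (ltW e2)) _.
by rewrite lte_fin ltr_pdivrMr// ltr_pMr// ltr1n.
Qed.

(** Requiring tightness of the complement too builds in closure under complements; a countable union
    then needs [tight_bigcup] for itself and [tight_bigcap] for its complement. *)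
Lemma tight_sigma_algebra (R : realType) d
    (p : {measure set (d.-tuple R) -> \bar R}) : fin_num_fun p ->
  sigma_algebra setT [set A | [/\ measurable A, tight p A & tight p (~` A)]].
Proof.
move=> pfin; have t0 : tight p set0 by apply: tuple_compact_tight; exact: compact0.
split.
- split => //; rewrite setC0.
  (* The whole space is the union of the compact cubes [[-n, n]^d]. *)
  rewrite (_ : setT = \bigcup_n [set s : d.-tuple R |
      forall i, - n%:R <= tnth s i <= n%:R]); last first.
    apply/seteqP; split => // s _.
    pose M := \big[Num.max/0]_(i < d) `|tnth s i|.
    have [n _ /(_ n (leqnn n)) /= Mn] := nbhs_infty_gtr M.
    exists n => // i; rewrite -ler_norml (le_trans _ (ltW Mn))//.
    exact: (le_bigmax_cond _ (fun i => `|tnth s i|)).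
  apply: tight_bigcup => // n.
    by apply: tuple_compact_measurable; exact: tuple_compact_box.
  by apply: tuple_compact_tight; exact: tuple_compact_box.
- move=> A [mA tA tcA]; rewrite setTD; split; rewrite ?setCK//.
  exact: measurableC.
- move=> F FP; split.
  + by apply: bigcup_measurable => n _; case: (FP n).
  + by apply: tight_bigcup => // n; case: (FP n).
  + rewrite setC_bigcup; apply: tight_bigcap => n; case: (FP n) => // mF _ _.
    exact: measurableC.
Qed.

(** Bounding the other coordinates by [m] exhausts each slab by compact boxes. Open half-spaces
    [x < tnth s i] and their complements are such unions of slabs. *)
Lemma tight_slab (R : realType) d (p : {measure set (d.-tuple R) -> \bar R}) (i : 'I_d)
    (a b : nat -> R) : fin_num_fun p ->
  tight p (\bigcup_n [set s | a n <= tnth s i <= b n]).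
Proof.
move=> pfin; rewrite (_ : \bigcup_n _ = \bigcup_n \bigcup_m [set s | forall j,
    (if j == i then a n else - m%:R) <= tnth s j <=
    (if j == i then b n else m%:R)]); last first.
  apply/seteqP; split => [s [n _ /= sn]|s [n _ [m _ /(_ i)]]]; last first.
    by rewrite eqxx; exists n.
  exists n => //; pose M := \big[Num.max/0]_(i < d) `|tnth s i|.
  have [m _ /(_ m (leqnn m)) /= Mm] := nbhs_infty_gtr M.
  exists m => // j; case: eqVneq => [->//|_].
  rewrite -ler_norml (le_trans _ (ltW Mm))//.
  exact: (le_bigmax_cond _ (fun i => `|tnth s i|)).
pose box n m : set (d.-tuple R) := [set s | forall j,
    (if j == i then a n else - m%:R) <= tnth s j <=
    (if j == i then b n else m%:R)].
have cbox n m : tuple_compact (box n m) by exact: tuple_compact_box.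
have mbox n m := tuple_compact_measurable (cbox n m).
apply: tight_bigcup => // n.
  by apply: bigcup_measurable => m _; exact: (mbox n m).
apply: tight_bigcup => // m; first exact: (mbox n m).
by apply: tuple_compact_tight; exact: (cbox n m).
Qed.

Lemma measurable_tight (R : realType) d
    (p : {measure set (d.-tuple R) -> \bar R}) A :
  fin_num_fun p -> measurable A -> tight p A.
Proof.
move=> pfin.
suff: measurable `<=` [set A | [/\ measurable A, tight p A & tight p (~` A)]].
  by move=> /[apply] -[].
apply: smallest_sub; first exact: tight_sigma_algebra.
rewrite -bigcup_seq; apply: bigcup_sub => i _ _ [C mC <-]; rewrite setTI.
move: C mC.
have -> : (measurable : set (set R)) = <<s @RGenOInfty.G R >>.
  exact: RGenOInfty.measurableE.
have [T0 TC TU] := tight_sigma_algebra pfin.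
(* For fixed [i], the sets [C] whose preimage under the [i]-th coordinate is good form a
   sigma-algebra, so open rays suffice. *)
apply: smallest_sub.
  by split => [|C /TC|F /TU].
move=> _ [x ->].
have mx : measurable (@tnth d R ^~ i @^-1` `]x, +oo[).
  rewrite -[X in measurable X]setTI.
  by apply: (@measurable_tnth _ R) => //; exact: measurable_itv.
split=> //.
- rewrite (_ : _ @^-1` _ = \bigcup_n [set s : d.-tuple R |
      x + n.+1%:R^-1 <= tnth s i <= n%:R]); first exact: tight_slab.
  apply/seteqP; split => s /=; rewrite in_itv /= andbT; last first.
    by move=> [n _ /= /andP[+ _]]; apply: lt_le_trans; rewrite ltrDl invr_gt0.
  move=> xs; have sx : 0 < tnth s i - x by rewrite subr_gt0.
  have [n1 _ n1P] := near_infty_natSinv_lt (PosNum sx).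
  have [n2 _ n2P] := nbhs_infty_gtr (tnth s i).
  exists (maxn n1 n2) => //=; apply/andP; split.
    by rewrite -lerBrDl ltW// n1P//= leq_maxl.
  by rewrite ltW// n2P//= leq_maxr.
- rewrite (_ : ~` _ = \bigcup_n [set s : d.-tuple R |
      - n%:R <= tnth s i <= x]); first exact: tight_slab.
  apply/seteqP; split => s /=; rewrite in_itv /= andbT; last first.
    by move=> [n _ /= /andP[_]]; rewrite leNgt => /negP.
  move/negP; rewrite -leNgt => sx; have [n _ nP] := nbhs_infty_gtr (- tnth s i).
  by exists n => //=; rewrite sx andbT lerNl ltW// nP/=.
Qed.

Lemma measurable_subvec (R : realType) d (rho : {set 'I_d}) :
  measurable_fun setT (@subvec R d rho).
Proof.
apply/measurable_fun_tnthP => k.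
rewrite (_ : _ \o _ = @tnth d R ^~ (enum_val k)); first exact: measurable_tnth.
by apply/funext => s /=; rewrite tnth_mktuple.
Qed.

(** * Saturated sets and functions *)

(** The measures enter asymmetrically: [p] through inner regularity, [p'] through being carried by
    [S]. Exchanging them later gives equality. *)
Lemma saturated_measure_le (R : realType) d (rho : {set 'I_d})
    (p p' : {measure set (d.-tuple R) -> \bar R}) (S B : set (d.-tuple R)) :
  fin_num_fun p -> measurable S -> p' (~` S) = 0%E ->
  (forall C, measurable C ->
    p [set s | C (subvec rho s)] = p' [set s | C (subvec rho s)]) ->
  measurable B -> B `<=` S ->
  (forall x y, S x -> S y -> subvec rho x = subvec rho y -> B x -> B y) ->
  (p B <= p' B)%E.
Proof.
move=> pfin mS p'S law mB BS satB; apply/lee_addgt0Pr => e e0.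
have [K [cK KB BK]] := measurable_tight pfin mB e0.
have mK := tuple_compact_measurable cK.
pose C := subvec rho @` K.
have mC : measurable C.
  by apply: tuple_compact_measurable; exact: tuple_compact_subvec.
have mC' : measurable [set s | C (subvec rho s)].
  by rewrite -[X in measurable X]setTI; exact: measurable_subvec.
rewrite (measureDI p mB mK) setIidr// addeC; apply: leeD; last exact: ltW.
apply: (@le_trans _ _ (p [set s | C (subvec rho s)])).
  by apply: le_measure; rewrite ?inE// => s Ks; exists s.
(* The part outside [S] is [p']-null; a point of [S] over [C] shares its subvector with a point of
   [K], so saturation puts it in [B]. *)
rewrite law// (measureDI p' mC' mS).
rewrite [X in (X + _)%E](_ : _ = 0%E) ?add0e.
  apply: le_measure; rewrite ?inE//; first exact: measurableI.
  by move=> s [[x Kx xs] Ss]; apply: (satB x s) => //; [apply: BS|]; exact: KB.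
by apply: (subset_measure0 _ _ _ p'S);
  [exact: measurableD|exact: measurableC|move=> s []].
Qed.

(** Change of variables to the law of [g], applied separately to the positive and negative parts,
    each a nonnegative function of [g x]. *)
Lemma eq_law_Rintegral (R : realType) d (T : measurableType d)
    (p p' : {measure set T -> \bar R}) (g : T -> R) :
  measurable_fun setT g ->
  (forall C, measurable C -> p (g @^-1` C) = p' (g @^-1` C)) ->
  \int[p]_x g x = \int[p']_x g x.
Proof.
move=> mg law; rewrite /Rintegral; congr fine.
have law_ge0 (f : R -> \bar R) : measurable_fun setT f ->
    (forall x, 0 <= f x)%E -> (\int[p]_x f (g x) = \int[p']_x f (g x))%E.
  move=> mf f0.
  rewrite -(@ge0_integral_pushforward _ _ _ _ _ g mg p setT f)//.
  rewrite -(@ge0_integral_pushforward _ _ _ _ _ g mg p' setT f)//.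
  by apply: eq_measure_integral => C mC _; exact: law.
have pos x : ((fun x => (g x)%:E)^\+ x = EFin^\+ (g x))%E by rewrite !funeposE.
have neg x : ((fun x => (g x)%:E)^\- x = EFin^\- (g x))%E by rewrite !funenegE.
rewrite integralE [RHS]integralE; congr (_ - _)%E.
- under eq_integral do rewrite pos; under [RHS]eq_integral do rewrite pos.
  apply: law_ge0 => [|x]; last exact: funepos_ge0.
  by apply: measurable_funepos; exact: EFin_measurable.
- under eq_integral do rewrite neg; under [RHS]eq_integral do rewrite neg.
  apply: law_ge0 => [|x]; last exact: funeneg_ge0.
  by apply: measurable_funeneg; exact: EFin_measurable.
Qed.

Lemma saturated_Rintegral (R : realType) d (rho : {set 'I_d})
    (p p' : {measure set (d.-tuple R) -> \bar R}) (S : set (d.-tuple R))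
    (f : d.-tuple R -> R) :
  fin_num_fun p -> fin_num_fun p' ->
  measurable S -> p (~` S) = 0%E -> p' (~` S) = 0%E ->
  (forall C, measurable C ->
    p [set s | C (subvec rho s)] = p' [set s | C (subvec rho s)]) ->
  measurable_fun S f ->
  (forall x y, S x -> S y -> subvec rho x = subvec rho y -> f x = f y) ->
  \int[p]_(x in S) f x = \int[p']_(x in S) f x.
Proof.
move=> pfin p'fin mS pS p'S law mf satf.
rewrite Rintegral_mkcond [RHS]Rintegral_mkcond.
have mfS : measurable_fun setT (f \_ S) by exact/(measurable_restrictT _ mS).
apply: eq_law_Rintegral => // C mC.
have mE : measurable ((f \_ S) @^-1` C).
  by rewrite -[X in measurable X]setTI; exact: mfS.
(* The extension of [f] is 0 off [S], so its preimage of [C] contains the complement of [S] when [C]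
   contains 0; discarding this null part leaves a saturated subset of [S]. *)
have null (q : {measure set (d.-tuple R) -> \bar R}) : q (~` S) = 0%E ->
    q ((f \_ S) @^-1` C) = q ((f \_ S) @^-1` C `&` S).
  move=> qS; rewrite (measureDI q mE mS) [X in (X + _)%E](_ : _ = 0%E) ?add0e//.
  by apply: (subset_measure0 _ _ _ qS);
    [exact: measurableD|exact: measurableC|move=> s []].
have mES : measurable ((f \_ S) @^-1` C `&` S) by exact: measurableI.
rewrite !null//.
have sat x y : S x -> S y -> subvec rho x = subvec rho y ->
    ((f \_ S) @^-1` C `&` S) x -> ((f \_ S) @^-1` C `&` S) y.
  move=> Sx Sy xy [Cx _]; split=> //; rewrite /preimage /=.
  suff -> : (f \_ S) y = (f \_ S) x by [].
  by rewrite !patchE !mem_set// -(satf x y).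
apply/eqP; rewrite eq_le; apply/andP; split.
  by apply: (saturated_measure_le (rho := rho) pfin mS).
apply: (saturated_measure_le (rho := rho) p'fin mS) => //.
by move=> D mD; rewrite law.
Qed.

(** * Measurability of the optimal q-functions *)

Lemma measurable_fun_sup_fin (R : realType) d (T : measurableType d)
    (D : set T) (A : finType) (h : T -> A -> R) :
  (forall a, measurable_fun D (h ^~ a)) ->
  measurable_fun D (fun x => sup [set h x a | a in [set: A]]).
Proof.
move=> mh; have [a0 _|A0] := pickP (fun _ : A => true); last first.
  rewrite (_ : (fun _ => _) = cst (sup set0)); first exact: measurable_cst.
  apply/funext => x; congr sup; apply/seteqP; split => // y [a].
  by have := A0 a.
(* The default [h x a0] of the iterated maximum is one of its terms, so it does not change the
   value. *)
rewrite (_ : (fun _ => _) =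
    fun x => \big[Num.max/h x a0]_(a <- enum A) h x a); last first.
  apply/funext => x; have [a -> ha] := sup_is_max (h x) a0.
  apply/eqP; rewrite eq_le; apply/andP; split.
    by apply: le_bigmax_seq => //; rewrite mem_enum.
  by apply: bigmax_le => // b _; exact: ha.
elim: (enum A) => [|a s ih].
  by under eq_fun do rewrite big_nil; exact: mh.
by under eq_fun do rewrite big_cons; exact: measurable_maxr.
Qed.

(** Makes the expectation in the Bellman recursion measurable in the current state. *)
Lemma measurable_fun_Rintegral_kernel (R : realType) d d'
    (X : measurableType d) (Y : measurableType d') (k : R.-ker X ~> Y)
    (S : set Y) (f : Y -> R) :
  measurable S -> measurable_fun S f ->
  measurable_fun setT (fun x => \int[k x]_(y in S) f y).
Proof.
move=> mS mf.
under eq_fun do rewrite Rintegral_mkcond.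
have mfS : measurable_fun setT (EFin \o (f \_ S)).
  by apply/measurable_EFinP; exact/(measurable_restrictT _ mS).
apply: (measurableT_comp (fine_measurable measurableT)).
under eq_fun do rewrite integralE.
apply: emeasurable_funB; apply: measurable_fun_integral_kernel;
  [exact: measurable_kernel|exact: funepos_ge0|exact: measurable_funepos
  |exact: measurable_kernel|exact: funeneg_ge0|exact: measurable_funeneg].
Qed.

Lemma measurable_qstar_rec (R : realType) d (A : finType) (M : mdp R d A) n t a :
  measurable_fun (states M) (fun s => qstar_rec M n t s a).
Proof.
elim: n t a => [|n ih] t a /=; first exact: measurable_cst.
apply: measurable_funD; first exact: measurable_reward.
apply: measurable_funM; first exact: measurable_cst.
apply: measurable_funTS; apply: measurable_fun_Rintegral_kernel.
  exact: measurable_states.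
exact: measurable_fun_sup_fin.
Qed.

Lemma trans_statesC (R : realType) d (A : finType) (M : mdp R d A) t a s :
  states M s -> trans M t a s (~` states M) = 0%E.
Proof.
move=> Ms; have mS := measurable_states M.
have fk := finite_kernel_measure (trans M t a) s.
rewrite -setTD measureD//; last by rewrite -ge0_fin_numE// fk.
rewrite setTI -(@subee R 1%E)//; congr (_ - _)%E; first exact: prob_kernel.
exact: trans_states.
Qed.

(** * Backward induction and optimal actions *)

(** The bounds on [t] and [n + t] keep the decision times [t], ..., [t + n - 1] among the epochs,
    where the assumptions on rewards and transitions hold. *)
Lemma qstar_rec_subvec (R : realType) d (A : finType) (M : mdp R d A)
    (rho : {set 'I_d}) n t s s' a :
  (forall t, epoch M t -> reward_depends_on M rho t) ->
  (forall t, epoch M t -> trans_depends_on M rho t) ->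
  (0 < t)%N -> (n + t <= (horizon M).+1)%N ->
  states M s -> states M s' -> subvec rho s = subvec rho s' ->
  qstar_rec M n t s a = qstar_rec M n t s' a.
Proof.
move=> Hr Ht; elim: n t s s' a => //= n ih t s s' a t0 nt Ms Ms' ss'.
have et : epoch M t.
  by rewrite /epoch t0 -ltnS (leq_trans _ nt)// addSn ltnS leq_addl.
congr (_ + _ * _); first exact: Hr.
have [K KE] := Ht t et.
apply: (saturated_Rintegral (rho := rho)).
- exact: finite_kernel_measure.
- exact: finite_kernel_measure.
- exact: measurable_states.
- exact: trans_statesC.
- exact: trans_statesC.
- by move=> C mC; rewrite !KE// ss'.
- by apply: measurable_fun_sup_fin => a'; exact: measurable_qstar_rec.
- move=> x y Mx My xy; congr sup; apply: eq_imagel => a' _.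
  by apply: ih => //; rewrite addnS.
Qed.

(** When several actions are optimal, two optimal policies may pick different ones; the chosen
    actions are therefore compared under uniqueness or a common selection rule, while the argmax
    sets always agree. *)
Theorem proposition1 (R : realType) (d : nat) (A : finType) (M : mdp R d A)
    (phi : d.-tuple R -> A -> d.-tuple R) (rho : {set 'I_d})
    (Mlin : linear_mdp M phi)
    (Hreward : forall t : nat, epoch M t -> reward_depends_on M rho t)
    (Htrans : forall t : nat, epoch M t -> trans_depends_on M rho t)
    (t : nat) (ht : epoch M t) (s s' : d.-tuple R)
    (hs : states M s) (hs' : states M s')
    (hss' : subvec rho s = subvec rho s') :
  argmax (qstar M t s) = argmax (qstar M t s') /\
  forall pi pi' : nat -> d.-tuple R -> A,
    argmax (qstar M t s) (pi t s) -> argmax (qstar M t s') (pi' t s') ->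
    (exists a : A, argmax (qstar M t s) = [set a]) \/
      common_tie_breaking M pi pi' ->
    pi t s = pi' t s'.
Proof.
have qE : qstar M t s = qstar M t s'.
  case/andP: (ht) => t0 tT; apply/funext => a.
  by apply: (qstar_rec_subvec (rho := rho)) => //; rewrite subnK// ltnW.
rewrite qE; split=> // pi pi' pis pis' [[a sa]|[sel selP]].
  by move: pis pis'; rewrite sa => -> ->.
have [-> _] := selP t s ht hs; have [_ ->] := selP t s' ht hs'.
by rewrite qE.
Qed.
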